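(* Let $A=(a_{ij})$ be a real $n\times n$ matrix, and denote $$\mathcal{K}_U^{(i,j)}=\frac{n}{tr(A)}\,|a_{ii}-a_{jj}|,\qquad \mathcal{K}_U=\max_{\substack{1\le i,j\le n\\ i\ne j}}\mathcal{K}_U^{(i,j)} .$$ Given a pair of positive small values $(\varepsilon,\delta)$, the inequality $$\Pr\left(\,|tr_D^N(A)-tr(A)|\le\varepsilon\, tr(A)\,\right)\ge 1-\delta$$ holds with $D=U_1$ if $$N\ >\ \frac{\mathcal{K}_U^2}{2}\,c(\varepsilon,\delta)\ \equiv\ \mathcal{F},\qquad c(\varepsilon,\delta):=\varepsilon^{-2}\ln(2/\delta),$$ and with $D=U_2$ if $$N\ \ge\ \frac{n+1}{1+\frac{n-1}{\mathcal{F}}} .$$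
   Context: $tr(A)$ denotes the trace of $A$. For $D\in\{U_1,U_2\}$ and sample size $N$, the trace estimator is $tr_D^N(A):=\frac1N\sum_{i=1}^N w_i^tAw_i$, where the random vectors $w_1,\dots,w_N$ are drawn uniformly from among the $n$ columns of the scaled identity matrix $\sqrt n\, I$: with replacement for $D=U_1$, and without replacement (so that $N\le n$) for $D=U_2$.
   Formalization: The formal statement assumes tr(A) > 0: for tr(A) = 0 the quantity K_U is undefined, and for tr(A) < 0 the event is empty, so the claim fails (e.g. A = -I, ε = δ = 0.1). At F = 0 the U_2 threshold is read as its limit 0. *)

(* Defs.v *)
From HB Require Import structures.
From mathcomp Require Import all_boot all_order all_algebra.
From mathcomp Require Import all_classical all_reals all_analysis.

Set Implicit Arguments.
Unset Strict Implicit.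
Unset Printing Implicit Defensive.

Import Order.TTheory GRing.Theory Num.Theory.
Local Open Scope classical_set_scope.
Local Open Scope ring_scope.

Definition scaled_unit (R : realType) (n : nat) (j : 'I_n) : 'cV[R]_n :=
  col j (Num.sqrt n%:R)%:M.

Definition trace_estimator (R : realType) (n N : nat) (A : 'M[R]_n)
    (w : 'I_N -> 'cV[R]_n) : R :=
  N%:R^-1 * \sum_(i < N) ((w i)^T *m A *m w i) 0 0.

Section Sampling.
Context (R : realType) (d : measure_display) (T : measurableType d).
Variables (P : probability T R) (n N : nat) (w : 'I_N -> T -> 'cV[R]_n).

(* There is no sigma-algebra on 'cV[R]_n: since the w i take finitely many
   values, they are random vectors as soon as their level sets are events. *)
Definition drawn_from_columns : Prop :=
  (forall i t, exists j, w i t = scaled_unit R j) /\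
  (forall i j, measurable [set t | w i t = scaled_unit R j]).

(* For discrete random vectors, mutual independence amounts to the product
   rule for the level sets of every subfamily. *)
Definition mutually_independent_draws : Prop :=
  forall (J : {set 'I_N}) (s : 'I_N -> 'I_n),
    P [set t | forall i, i \in J -> w i t = scaled_unit R (s i)] =
    (\prod_(i in J) P [set t | w i t = scaled_unit R (s i)])%E.

Definition drawn_with_replacement : Prop :=
  [/\ drawn_from_columns,
      forall i j, P [set t | w i t = scaled_unit R j] = (n%:R^-1)%:E
    & mutually_independent_draws].

(* All the n ^_ N = n (n - 1) ... (n - N + 1) ordered samples of N distinct
   columns are equally likely; hence the other samples have probability 0. *)
Definition drawn_without_replacement : Prop :=
  [/\ (N <= n)%N, drawn_from_columns
    & forall s : 'I_N -> 'I_n, injective s ->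
        P [set t | forall i, w i t = scaled_unit R (s i)] =
        ((n ^_ N)%:R^-1)%:E].

End Sampling.

Definition KU_ij (R : realType) (n : nat) (A : 'M[R]_n) (i j : 'I_n) : R :=
  n%:R / \tr A * `|A i i - A j j|.

(* When 0 < \tr A the KU_ij are nonnegative, so that 0 is neutral here; it is
   also the value of the empty maximum when n = 1. *)
Definition KU (R : realType) (n : nat) (A : 'M[R]_n) : R :=
  \big[Num.max/0]_(p : 'I_n * 'I_n | p.1 != p.2) KU_ij A p.1 p.2.

Definition c_bound (R : realType) (eps delta : R) : R :=
  eps ^- 2 * ln (2 / delta).

Definition F_bound (R : realType) (n : nat) (A : 'M[R]_n) (eps delta : R) : R :=
  KU A ^+ 2 / 2 * c_bound eps delta.

(* The threshold (n + 1) / (1 + (n - 1) / F), extended at F = 0 by its limit 0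
   (a / 0 = 0 in MathComp would instead give the value n + 1). *)
Definition without_replacement_bound (R : realType) (n : nat) (F : R) : R :=
  if F == 0 then 0 else (n%:R + 1) / (1 + (n%:R - 1) / F).

(* Main.v *)
Require Import Defs.
From mathcomp Require Import all_boot all_order all_algebra.
From mathcomp Require Import all_classical all_reals all_analysis.
From mathcomp Require Import ring lra.

Set Implicit Arguments.
Unset Strict Implicit.
Unset Printing Implicit Defensive.

Import Order.TTheory GRing.Theory Num.Theory.
Import numFieldNormedType.Exports.
Local Open Scope classical_set_scope.
Local Open Scope ring_scope.

(** With w = sqrt n e_j the quadratic form w^T A w is the number n a_jj, so
    N times the estimator is the sum of N draws from the population
    f j = n a_jj, whose mean is tr A and whose values lie in an interval of
    length c = K_U tr A.  Two tail bounds for such sums give the theorem: for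
    every t > 0 the proportion of samples whose sum deviates from N tr A by
    more than t is at most 2 exp (- 2 t^2 / v), where
      - v = c^2 N with replacement (Hoeffding),
      - v = c^2 N (n - N + 1) / n without replacement (Serfling).
    For t = N eps tr A the exponent is 2 eps^2 / K_U^2 times N, respectively
    times N n / (n - N + 1), and it is at least ln (2 / delta) as soon as that
    factor is at least F.  The threshold (n + 1) / (1 + (n - 1) / F) is
    slightly larger than the value (n + 1) / (1 + n / F) at which
    N n / (n - N + 1) reaches F.

    Both tail bounds follow by the Chernoff method ([chernoff_two_sided]) from
    a bound exp (lam^2 v / 8) on the average of exp (lam (S - E S)), and both
    exponential moments are obtained by induction on N, isolating the first
    draw and applying Hoeffding's lemma ([hoeffding_lemma]) to it.  With
    replacement the remaining draws are a sample of the same population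
    ([mgf_with_replacement]).  Without replacement they form a sample of size
    N - 1 of the population B \ x; its mean mu' differs from mu by
    -(f x - mu) / (b - 1), where b = #|B|, so that
      S - N mu = (S' - (N - 1) mu') + (b - N) / (b - 1) (f x - mu).
    Hence the variance factor can be c^2 V b N for any V with
      ((b - N) / (b - 1))^2 + V (b - 1) (N - 1) <= V b N,
    and V b N = N (b - N + 1) / b is one ([serfling_variance_step]), which
    gives [serfling_mgf].

    All these are statements about averages over finite sets of tuples of
    indices; [probability_draws] transfers them to the probability space. *)

(** * Hoeffding's lemma *)

Lemma ge0_of_derive_ge0 (R : realType) (g dg : R -> R) :
  (forall x : R, is_derive x 1 g (dg x)) -> (forall x, 0 <= x -> 0 <= dg x) ->
  g 0 = 0 -> forall x, 0 <= x -> 0 <= g x.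
Proof.
move=> g_dg dg_ge0 g0 x x_ge0.
have [|c c0x] := @MVT_segment R g dg 0 x x_ge0 (fun y _ => g_dg y).
  apply: continuous_subspaceT => y.
  by apply: differentiable_continuous; apply/derivable1_diffP; case: (g_dg y).
rewrite g0 !subr0 => ->; rewrite mulr_ge0// dg_ge0//.
by move: c0x; rewrite in_itv/= => /andP[].
Qed.

(** The difference of the logarithms of both sides and its derivative in [u]
    vanish at 0, and its second derivative is 1/4 - q (1 - q) >= 0, where
    q = p e^u / (1 - p + p e^u) is the success probability of the
    exponentially tilted Bernoulli law. *)
Lemma bernoulli_mgf_le (R : realType) (p u : R) : 0 <= p <= 1 -> 0 <= u ->
  1 - p + p * expR u <= expR (u ^+ 2 / 8 + p * u).
Proof.
move=> /andP[p0 p1].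
pose m v := 1 - p + p * expR v : R.
have m_gt0 v : 0 < m v.
  rewrite /m; have := expR_gt0 v; have [->|pn0] := eqVneq p 0; first lra.
  move=> e0; apply: ltr_wpDl; first lra.
  by rewrite mulr_gt0// lt_neqAle eq_sym pn0.
have dm (v : R) : is_derive v 1 m (p * expR v).
  by apply: is_derive_eq; rewrite add0r /GRing.scale/= ; ring.
pose q v := p * expR v / m v.
have dq (v : R) : is_derive v 1 q (q v * (1 - q v)).
  have mn0 := lt0r_neq0 (m_gt0 v).
  by rewrite /q; apply: is_derive_eq; rewrite /GRing.scale/=; field.
have dk (v : R) :
    is_derive v 1 (fun v : R => v / 4 + p - q v) (4^-1 - q v * (1 - q v)).
  by apply: is_derive_eq; rewrite /GRing.scale/=; ring.
(* The first derivative of the difference of the logarithms. *)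
have k_ge0 v : 0 <= v -> 0 <= v / 4 + p - q v.
  apply: (@ge0_of_derive_ge0 _ (fun v => v / 4 + p - q v) _ dk) => [x _|].
    by have := sqr_ge0 (q x - 2^-1); rewrite expr2; lra.
  by rewrite /q /m expR0; field; lra.
have dg (v : R) : is_derive v 1 (fun v : R => v ^+ 2 / 8 + p * v - ln (m v))
                          (v / 4 + p - q v).
  have dln := is_derive1_ln (m_gt0 v).
  have dlm := is_derive1_comp dln (dm v).
  apply: is_derive_eq.
  by rewrite /GRing.scale/= /q; field; rewrite lt0r_neq0.
move=> u0.
have := @ge0_of_derive_ge0 _ _ _ dg k_ge0 _ u u0.
rewrite subr_ge0 => H; rewrite -/(m u) -[m u]lnK ?posrE// ler_expR; apply: H.
by rewrite /m expR0 !mulr0 mulr1 subrK ln1; lra.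
Qed.

(** The tangent to [expR] at [q * u] lies below [expR] at both 0 and [u];
    average these two inequalities with weights [1 - q] and [q]. *)
Lemma expR_le_chord (R : realType) (q u : R) : 0 <= q <= 1 ->
  expR (q * u) <= 1 - q + q * expR u.
Proof.
move=> /andP[q0 q1].
have H y : expR (q * u) * (1 + (y - q * u)) <= expR y.
  rewrite -[leRHS](_ : expR (q * u) * expR (y - q * u) = _); last first.
    by rewrite -expRD; congr expR; ring.
  by rewrite ler_wpM2l ?expR_ge0 ?expR_ge1Dx.
have := H 0; have := H u; rewrite expR0; nra.
Qed.

Definition mean (R : realType) (I : finType) (B : {set I}) (f : I -> R) : R :=
  (\sum_(x in B) f x) / #|B|%:R.

(** Between [a] and [a + c] the exponential lies below its chord, and averaging the
    chord replaces the population by the Bernoulli law on {a, a + c} with the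
    same mean, to which [bernoulli_mgf_le] applies. *)
Lemma hoeffding_lemma (R : realType) (I : finType) (B : {set I}) (f : I -> R)
    (a c lam : R) : 0 < c -> 0 <= lam ->
  {in B, forall x, a <= f x <= a + c} ->
  \sum_(x in B) expR (lam * (f x - mean B f)) <=
  #|B|%:R * expR ((lam * c) ^+ 2 / 8).
Proof.
move=> c0 l0 fB.
have [->|Bn0] := eqVneq B finset.set0; first by rewrite big_set0 cards0 mul0r.
have b0 : 0 < #|B|%:R :> R by rewrite ltr0n card_gt0.
set b := #|B|%:R in b0 *.
set mu := mean B f.
(* The weight of the endpoint [a + c] when [f x] is written as a barycenter. *)
pose q x := (f x - a) / c.
have sumq : \sum_(x in B) q x = b * ((mu - a) / c).
  rewrite -mulr_suml big_split/= sumr_const -[- a *+ _]mulr_natr -/b.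
  by rewrite /mu /mean -/b; field; rewrite !lt0r_neq0.
have q01 x : x \in B -> 0 <= q x <= 1.
  move=> /fB /andP[? ?]; rewrite /q divr_ge0 ?ler_pdivrMr//=; lra.
have p01 : 0 <= (mu - a) / c <= 1.
  have : 0 <= \sum_(x in B) q x <= b.
    rewrite sumr_ge0//=; last by move=> x /q01/andP[].
    rewrite /b -sum1_card natr_sum; apply: ler_sum => x /q01/andP[]//.
  by rewrite sumq pmulr_rge0// ger_pMr.
have -> : \sum_(x in B) expR (lam * (f x - mu)) =
          expR (- (lam * (mu - a))) * \sum_(x in B) expR (q x * (lam * c)).
  rewrite mulr_sumr; apply: eq_bigr => x _; rewrite -expRD; congr expR.
  by rewrite /q; field; rewrite lt0r_neq0.
rewrite -[leRHS](_ : expR (- (lam * (mu - a))) *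
   (b * expR ((lam * c) ^+ 2 / 8 + (mu - a) / c * (lam * c))) = _); last first.
  rewrite mulrCA -expRD; congr (_ * expR _).
  by field; rewrite lt0r_neq0.
rewrite ler_wpM2l ?expR_ge0//.
apply: le_trans
  (_ : _ <= b * (1 - (mu - a) / c + (mu - a) / c * expR (lam * c))) _.
  rewrite [leRHS](_ : _ = \sum_(x in B) (1 - q x + q x * expR (lam * c))).
    by apply: ler_sum => x xB; rewrite expR_le_chord ?q01.
  rewrite big_split/= sumrB sumq -mulr_suml sumq sumr_const -/b; ring.
by rewrite ler_pM2l// bernoulli_mgf_le// mulr_ge0// ltW.
Qed.

(** * Exponential moments of sample sums *)

(** The first-draw decomposition behind both inductions on the sample size. *)
Lemma sum_tuple_cons (V : nmodType) (I : finType) (N : nat)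
    (Q : pred (seq I)) (F : seq I -> V) :
  \sum_(s : N.+1.-tuple I | Q s) F s =
  \sum_(x : I) \sum_(s : N.-tuple I | Q (x :: s)) F (x :: s).
Proof.
rewrite pair_big_dep/=.
rewrite (reindex (fun p : I * N.-tuple I => [tuple of p.1 :: p.2]))//=.
exists (fun s : N.+1.-tuple I => (thead s, [tuple of behead s])) => [[x s]|s] _.
  by congr (_, _); apply/val_inj.
by rewrite /= -tuple_eta.
Qed.

Lemma mgf_with_replacement (R : realType) (I : finType) (f : I -> R)
    (a c lam : R) (N : nat) : 0 < c -> 0 <= lam ->
  (forall x, a <= f x <= a + c) ->
  \sum_(s : N.-tuple I)
    expR (lam * (\sum_(x <- s) f x - N%:R * mean [set: I]%SET f)) <=
  (#|I| ^ N)%:R * expR ((lam * c) ^+ 2 / 8 * N%:R).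
Proof.
move=> c0 l0 fI; set mu := mean [set: I]%SET f; elim: N => [|N IHN].
  rewrite (big_pred1 [tuple])/= => [|s]; last by apply/esym/eqP; exact: tuple0.
  by rewrite big_nil mul0r subrr !mulr0 expn0 mul1r.
rewrite (sum_tuple_cons N xpredT
  (fun s => expR (lam * (\sum_(x <- s) f x - N.+1%:R * mu)))).
under eq_bigr => x _.
  under eq_bigr => s _.
    rewrite big_cons (_ : lam * _ = lam * (f x - mu) +
              lam * (\sum_(y <- s) f y - N%:R * mu)); last by rewrite -natr1; ring.
    rewrite expRD; over.
  rewrite -mulr_sumr; over.
rewrite -mulr_suml expnS natrM -(natr1 N) mulrDr mulr1 addrC expRD mulrACA.
apply: ler_pM => //.
- by apply: sumr_ge0 => x _; exact: expR_ge0.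
- by apply: sumr_ge0 => x _; exact: expR_ge0.
have := @hoeffding_lemma R I [set: I]%SET f a c lam c0 l0 (fun x _ => fI x).
by rewrite cardsT (eq_bigl xpredT)// => x; rewrite inE.
Qed.

(** The left side adds to the variance factor of the last [N] draws the square
    of the share (b - N - 1) / (b - 1) of the first draw's deviation that they
    leave uncompensated.  With m = b - 1 - N and b > 1, the right side exceeds
    it by m (b - 1 - m) / ((b - 1)^2 b). *)
Lemma serfling_variance_step (R : realType) (b N : nat) : (N < b)%N ->
  ((b - N.+1)%:R / b.-1%:R) ^+ 2 + N%:R * (b.-1 - N).+1%:R / b.-1%:R <=
  N.+1%:R * (b - N.+1).+1%:R / b%:R :> R.
Proof.
case: b => // b; rewrite ltnS => Nb /=; rewrite subSS.
have [b0|b_gt0] := posnP b.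
  by move: Nb; rewrite b0 leqn0 => /eqP->; rewrite !mul0r expr0n add0r divr_ge0.
have -> : N = (b - (b - N))%N by rewrite subKn.
move: (b - N)%N (leq_subr N b) => m mb.
have : 0 < b%:R :> R by rewrite ltr0n.
have : m%:R <= b%:R :> R by rewrite ler_nat.
have : 0 <= m%:R :> R by rewrite ler0n.
rewrite subKn// -!natr1 natrB//.
clear Nb b_gt0 mb; move: (b%:R : R) (m%:R : R) => {}b {}m m0 mb b0.
rewrite -subr_ge0.
rewrite [leRHS](_ : _ = m * (b - m) / (b ^+ 2 * (b + 1))); last first.
  by field; lra.
by rewrite divr_ge0 ?mulr_ge0 ?exprn_ge0; lra.
Qed.

(** Removing the first draw [x] moves the mean of the population away from
    [f x]; this compensates part of the deviation of [f x], which therefore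
    enters only with the factor [r] (see [muD] in the proof). *)
Lemma serfling_mgf (R : realType) (I : finType) (f : I -> R)
    (a c lam : R) (N : nat) (B : {set I}) : 0 < c -> 0 <= lam ->
  (N <= #|B|)%N -> {in B, forall x, a <= f x <= a + c} ->
  \sum_(s : N.-tuple I | all (mem B) s && uniq s)
    expR (lam * (\sum_(x <- s) f x - N%:R * mean B f)) <=
  (#|B| ^_ N)%:R *
    expR ((lam * c) ^+ 2 / 8 * (N%:R * (#|B| - N).+1%:R / #|B|%:R)).
Proof.
move=> c0 l0; elim: N B => [|N IHN] B NB fB.
  rewrite (big_pred1 [tuple])/= => [|s].
    by rewrite big_nil !mul0r subrr !mulr0 ffactn0 mul1r.
  by rewrite (tuple0 s)/=; apply/esym/eqP/val_inj.
rewrite (sum_tuple_cons N (fun s => all (mem B) s && uniq s)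
  (fun s => expR (lam * (\sum_(x <- s) f x - N.+1%:R * mean B f)))).
set b := #|B| in NB *; set mu := mean B f.
pose r := (b - N.+1)%:R / b.-1%:R : R.
have r_ge0 : 0 <= r by rewrite divr_ge0.
have b_gt0 : (0 < b)%N by exact: leq_ltn_trans NB.
have bR : b%:R = b.-1%:R + 1 :> R by rewrite natr1 prednK.
have cardD x : x \in B -> #|B :\ x| = b.-1.
  by move=> xB; rewrite /b (cardsD1 x B) xB.
have muD x : x \in B ->
    f x - mu + N%:R * (mean (B :\ x) f - mu) = r * (f x - mu).
  move=> xB.
  have bmu : b%:R * mu = f x + \sum_(y in B :\ x) f y.
    by rewrite /mu /mean mulrC divfK ?pnatr_eq0 -?lt0n// (big_setD1 x).
  rewrite /mean (cardD _ xB).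
  (* A population of one element: [r] is a division by zero, but f x = mu. *)
  have [b1|b1_gt0] := posnP b.-1.
    have N0 : N = 0%N by apply/eqP; rewrite -leqn0 -b1 -ltnS prednK.
    have BD : B :\ x = finset.set0 by apply/eqP; rewrite -cards_eq0 cardD// b1.
    move: bmu; rewrite bR /r b1 N0 BD big_set0 invr0; lra.
  have b1R : 0 < b.-1%:R :> R by rewrite ltr0n.
  have -> : \sum_(y in B :\ x) f y = b%:R * mu - f x by rewrite bmu addrC addKr.
  by rewrite /r natrB// -natr1 bR; field; rewrite lt0r_neq0.
have inner x : x \in B ->
    \sum_(s : N.-tuple I | all (mem B) (x :: s) && uniq (x :: s))
      expR (lam * (\sum_(y <- x :: s) f y - N.+1%:R * mu)) <=
    expR (lam * r * (f x - mu)) * ((b.-1 ^_ N)%:R *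
      expR ((lam * c) ^+ 2 / 8 * (N%:R * (b.-1 - N).+1%:R / b.-1%:R))).
  move=> xB.
  under eq_bigr => s _.
    rewrite big_cons (_ : lam * _ = lam * r * (f x - mu) +
        lam * (\sum_(y <- s) f y - N%:R * mean (B :\ x) f)); last first.
      by rewrite -[lam * r * _]mulrA -muD// -natr1; ring.
    rewrite expRD; over.
  rewrite -mulr_sumr ler_wpM2l ?expR_ge0// -(cardD _ xB).
  rewrite (eq_bigl (fun s : N.-tuple I => all (mem (B :\ x)) s && uniq s)).
    apply: IHN; first by rewrite cardD// -ltnS prednK.
    by move=> y; rewrite in_setD1 => /andP[_ /fB].
  move=> s; rewrite /= xB /= andbA; congr (_ && _).
  rewrite -has_pred1 -all_predC -all_predI.
  by apply: eq_all => y; rewrite /= !inE andbC.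
rewrite [leLHS](bigID (mem B))/= [X in _ + X]big1 ?addr0; last first.
  by move=> x xB; rewrite big_pred0// => s; rewrite /= (negbTE xB).
apply: le_trans (ler_sum _ inner) _.
rewrite -mulr_suml -(prednK b_gt0) ffactnS -pred_Sn natrM (prednK b_gt0).
have lr0 : 0 <= lam * r by rewrite mulr_ge0.
apply: le_trans (ler_wpM2r _ (hoeffding_lemma c0 lr0 fB)) _.
  by rewrite mulr_ge0 ?expR_ge0.
rewrite -/b mulrACA -expRD ler_wpM2l// ler_expR.
rewrite (_ : (lam * r * c) ^+ 2 / 8 = (lam * c) ^+ 2 / 8 * r ^+ 2); last ring.
rewrite -mulrDr ler_wpM2l ?divr_ge0 ?sqr_ge0//.
exact: serfling_variance_step.
Qed.

(** * Tail bounds *)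

(** Markov's inequality for exp (lam Y) at the optimal lam = 4 t / v. *)
Lemma chernoff_card (R : realType) (S : finType) (D : pred S) (Y : S -> R)
    (v t : R) : 0 < v -> 0 <= t ->
  (forall lam, 0 <= lam ->
     \sum_(s | D s) expR (lam * Y s) <= #|D|%:R * expR (lam ^+ 2 / 8 * v)) ->
  #|[pred s | D s & t < Y s]|%:R <= #|D|%:R * expR (- (2 * t ^+ 2 / v)).
Proof.
move=> v0 t0 mgf; pose lam := 4 * t / v.
have lam0 : 0 <= lam by rewrite divr_ge0 ?mulr_ge0// ltW.
have -> : expR (- (2 * t ^+ 2 / v)) =
    expR (lam ^+ 2 / 8 * v) * expR (- (lam * t)).
  rewrite -expRD; congr expR.
  by rewrite /lam; field; rewrite lt0r_neq0.
rewrite mulrA; apply: le_trans (ler_wpM2r (expR_ge0 _) (mgf _ lam0)).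
rewrite mulr_suml -sum1_card natr_sum.
rewrite [leRHS](bigID (fun s => t < Y s))/=.
apply: ler_wpDr; first by apply: sumr_ge0 => s _; rewrite mulr_ge0 ?expR_ge0.
apply: ler_sum => s /andP[_ tY]; rewrite -expRD -mulrBr.
by rewrite -[leLHS]expR0 ler_expR mulr_ge0// subr_ge0 ltW.
Qed.

(** The sign [(-1) ^+ b] lets one hypothesis cover both tails: the exponential
    moment bounds are proved for [lam >= 0] only. *)
Lemma chernoff_two_sided (R : realType) (S : finType) (D : pred S) (Y : S -> R)
    (v t : R) : 0 < v -> 0 <= t ->
  (forall (b : bool) lam, 0 <= lam ->
     \sum_(s | D s) expR (lam * ((-1) ^+ b * Y s)) <=
     #|D|%:R * expR (lam ^+ 2 / 8 * v)) ->
  #|[pred s | D s & t < `|Y s|]|%:R <=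
    #|D|%:R * (2 * expR (- (2 * t ^+ 2 / v))).
Proof.
move=> v0 t0 mgf.
rewrite mulrCA mulr2n mulrDl !mul1r.
apply: le_trans (lerD (chernoff_card v0 t0 (mgf false))
                     (chernoff_card v0 t0 (mgf true))).
rewrite -natrD ler_nat -cardUI; apply: leq_trans (leq_addr _ _).
apply/subset_leq_card/fintype.subsetP => s.
rewrite !inE ltr_normr expr0 expr1 mul1r mulN1r.
by case: (D s).
Qed.

(** * The trace estimator on samples of columns *)

Lemma scaled_unit_inj (R : realType) (n : nat) : injective (@scaled_unit R n).
Proof.
move=> i j /matrixP/(_ i 0); rewrite !mxE eqxx mulr1n.
have [//|_ /eqP] := eqVneq i j.
rewrite mulr0n sqrtr_eq0 leNgt ltr0n.
by rewrite (leq_ltn_trans _ (ltn_ord i)).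
Qed.

Lemma trace_estimator_scaled_unit (R : realType) (n N : nat) (A : 'M[R]_n)
    (s : N.-tuple 'I_n) :
  trace_estimator A (fun i => scaled_unit R (tnth s i)) =
  N%:R^-1 * \sum_(x <- s) n%:R * A x x.
Proof.
rewrite /trace_estimator big_tuple; congr (_ * _); apply: eq_bigr => i _.
have -> : scaled_unit R (tnth s i) =
          Num.sqrt n%:R *: delta_mx (tnth s i) 0 :> 'cV[R]_n.
  apply/matrixP => k l; rewrite !mxE (ord1 l) eqxx andbT.
  by rewrite mulr_natr.
rewrite [(_ *: _)^T]linearZ/= -!scalemxAl -scalemxAr scalerA -expr2 sqr_sqrtr//.
by rewrite trmx_delta -rowE -colE !mxE.
Qed.

Lemma mean_trace (R : realType) (n : nat) (A : 'M[R]_n) : (0 < n)%N ->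
  mean [set: 'I_n]%SET (fun x => n%:R * A x x) = \tr A.
Proof.
move=> n0; rewrite /mean -mulr_sumr cardsT card_ord mulrC mulKf ?pnatr_eq0 -?lt0n//.
by apply: eq_bigl => x; rewrite inE.
Qed.

(** * From counting samples to probabilities *)

Section law.
Context (R : realType) (d : measure_display) (T : measurableType d).
Variables (P : probability T R) (n N : nat) (w : 'I_N -> T -> 'cV[R]_n).
Context (w_cols : drawn_from_columns w).

Definition draws (s : N.-tuple 'I_n) : set T :=
  [set t | forall i, w i t = scaled_unit R (tnth s i)].

Lemma measurable_draws s : measurable (draws s).
Proof.
rewrite (_ : draws s =
    \bigcap_(i in setT) [set t | w i t = scaled_unit R (tnth s i)]).
  by apply: fin_bigcap_measurable => // i _; case: w_cols.
by apply/seteqP; split => t /= ws i => [_|]; apply: ws.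
Qed.

Lemma draws_total t : exists s, draws s t.
Proof.
case: w_cols => cols _.
have [s sP] := choice (fun i => cols i t).
by exists [tuple s i | i < N] => i; rewrite tnth_mktuple.
Qed.

(** The events [draws s] partition the probability space, the columns
    sqrt n e_j being distinct; in particular every event defined through [w]
    is measurable. *)
Lemma probability_draws (Q : ('I_N -> 'cV[R]_n) -> bool) :
  P [set t | Q (fun i => w i t)] =
  (\sum_(s : N.-tuple 'I_n | Q (fun i => scaled_unit R (tnth s i))) P (draws s))%E.
Proof.
rewrite (_ : [set t | Q (fun i => w i t)] = \bigcup_(s in
   [set s | Q (fun i => scaled_unit R (tnth s i))]) draws s).
  rewrite measure_fin_bigcup.
  - by rewrite (bigfs _ (index_enum_uniq _))// => s _; rewrite mem_index_enum.
  - exact: finite_finset.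
  - move=> s s' _ _ [t [/= ts ts']]; apply/eq_from_tnth => i.
    by apply: (@scaled_unit_inj R); rewrite -ts -ts'.
  - by move=> s _; exact: measurable_draws.
apply/seteqP; split => t /=.
  move=> Qt; have [s ts] := draws_total t; exists s => //=.
  by rewrite (_ : (fun _ => _) = (fun i => w i t))//; apply/funext => i.
move=> [s /= Qs ts].
by rewrite (_ : (fun _ => _) = (fun i => scaled_unit R (tnth s i)))//; apply/funext.
Qed.

Lemma probability_draws_ge (Q : ('I_N -> 'cV[R]_n) -> bool)
    (D : pred (N.-tuple 'I_n)) (p : R) :
  (forall s, D s -> P (draws s) = p%:E) ->
  ((#|[pred s : N.-tuple 'I_n |
        D s & Q (fun i => scaled_unit R (tnth s i))]|%:R * p)%:E
    <= P [set t | Q (fun i => w i t)])%E.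
Proof.
move=> Dp; rewrite probability_draws (bigID D)/=.
apply: le_trans (leeDl _ (sume_ge0 _ _)); last by [].
rewrite (eq_bigr (fun _ => p%:E)) => [|s /andP[_ /Dp]//].
rewrite (eq_bigl [pred s : N.-tuple 'I_n |
    D s & Q (fun i => scaled_unit R (tnth s i))]); last first.
  by move=> s; rewrite /= andbC.
by rewrite sumEFin sumr_const mulr_natl.
Qed.

End law.

(** * Concentration of the trace estimator *)

Lemma interval_of_spread (R : realType) (I : finType) (i0 : I) (g : I -> R)
    (c : R) : (forall i j, `|g i - g j| <= c) ->
  exists a, forall x, a <= g x <= a + c.
Proof.
move=> gc; have [i _ imin] := @arg_minP _ _ _ i0 xpredT g isT.
exists (g i) => x; rewrite imin//=.
by have := gc x i; rewrite ler_norml; lra.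
Qed.

Lemma KU_ge0 (R : realType) (n : nat) (A : 'M[R]_n) : 0 <= KU A.
Proof. exact: bigmax_ge_id. Qed.

Lemma diagonal_spread (R : realType) (n : nat) (A : 'M[R]_n) : 0 < \tr A ->
  forall i j, `|n%:R * A i i - n%:R * A j j| <= KU A * \tr A.
Proof.
move=> tr0 i j; have [->|ij] := eqVneq i j.
  by rewrite subrr normr0 mulr_ge0 ?KU_ge0 ?ltW.
have : KU_ij A i j <= KU A.
  exact: (@le_bigmax_cond _ _ _ _ (i, j) _ (fun p => KU_ij A p.1 p.2)).
rewrite -(ler_pM2r tr0); apply: le_trans.
rewrite -mulrBr normrM normr_nat /KU_ij.
by rewrite le_eqVlt; apply/orP; left; apply/eqP; field; rewrite lt0r_neq0.
Qed.

Lemma two_expRN_le (R : realType) (delta x : R) : 0 < delta ->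
  ln (2 / delta) <= x -> 2 * expR (- x) <= delta.
Proof.
move=> d0 lx; have d2 : 0 < 2 / delta by rewrite divr_gt0.
apply: (@le_trans _ _ (2 * expR (- ln (2 / delta)))).
  by rewrite ler_wpM2l// ler_expR lerN2.
by rewrite expRN lnK ?posrE// invf_div mulrCA divff ?mulr1.
Qed.

(** The form common to both sampling schemes: [D] is the set of samples that
    are equally likely and carry the whole probability. *)
Lemma trace_estimator_concentration (R : realType) (d : measure_display)
    (T : measurableType d) (P : probability T R) (n N : nat)
    (w : 'I_N -> T -> 'cV[R]_n) (A : 'M[R]_n) (D : pred (N.-tuple 'I_n))
    (v e delta : R) :
  drawn_from_columns w -> (0 < N)%N -> (0 < #|D|)%N ->
  (forall s, D s -> P (draws w s) = (#|D|%:R^-1)%:E) ->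
  0 < v -> 0 <= e -> 0 < delta ->
  (forall (b : bool) lam, 0 <= lam ->
     \sum_(s | D s) expR (lam * ((-1) ^+ b *
        (\sum_(x <- s) n%:R * A x x - N%:R * \tr A))) <=
     #|D|%:R * expR (lam ^+ 2 / 8 * v)) ->
  ln (2 / delta) <= 2 * (N%:R * e) ^+ 2 / v ->
  ((1 - delta)%:E <=
    P [set t | (`|trace_estimator A (fun i => w i t) - \tr A| <= e)%R])%E.
Proof.
move=> w_cols N0 D0 PD v0 e0 delta0 mgf le_ln.
have NR : 0 < N%:R :> R by rewrite ltr0n.
have DR : 0 < #|D|%:R :> R by rewrite ltr0n.
pose Q (W : 'I_N -> 'cV[R]_n) := `|trace_estimator A W - \tr A| <= e.
apply: le_trans (probability_draws_ge w_cols Q PD).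
rewrite lee_fin ler_pdivlMr//.
have := chernoff_two_sided v0 (mulr_ge0 (ltW NR) e0) mgf.
set bad := [pred s | _ & _]; set good := [pred s | _ & _] => bad_le.
have -> : #|good|%:R = #|D|%:R - #|bad|%:R :> R.
  apply/eqP; rewrite eq_sym subr_eq -natrD -(cardID good D); apply/eqP.
  congr (_ + _)%:R; apply: eq_card => s; rewrite !inE /good/= /Q.
    by rewrite unfold_in; case: (D s).
  rewrite trace_estimator_scaled_unit unfold_in; case: (D s); rewrite //= andbT -ltNge.
  rewrite (_ : _ - _ = N%:R^-1 * (\sum_(x <- s) n%:R * A x x - N%:R * \tr A)).
    by rewrite normrM gtr0_norm ?invr_gt0// ltr_pdivlMl.
  by field; rewrite lt0r_neq0.
rewrite mulrBl mul1r lerD2l lerN2 mulrC; apply: le_trans bad_le _.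
by rewrite ler_wpM2l// two_expRN_le.
Qed.

(** [KU A = 0] means a constant diagonal, so the estimator is exact.  This case
    is separate because the tail bounds need c > 0. *)
Lemma trace_estimator_const (R : realType) (d : measure_display)
    (T : measurableType d) (n N : nat)
    (w : 'I_N -> T -> 'cV[R]_n) (A : 'M[R]_n) :
  drawn_from_columns w -> (0 < N)%N -> 0 < \tr A -> KU A = 0 ->
  forall t, trace_estimator A (fun i => w i t) = \tr A.
Proof.
move=> w_cols N0 tr0 K0 t; have [s ts] := draws_total w_cols t.
rewrite (_ : (fun i => w i t) = (fun i => scaled_unit R (tnth s i))); last first.
  by apply/funext => i; apply: ts.
rewrite trace_estimator_scaled_unit big_tuple.
have cst i j : n%:R * A i i = n%:R * A j j.
  apply/eqP; rewrite -subr_eq0 -normr_le0.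
  by rewrite (le_trans (diagonal_spread tr0 i j))// K0 mul0r.
have n0 : (0 < n)%N by apply: leq_trans (ltn_ord (tnth s (Ordinal N0))).
have trE i : n%:R * A i i = \tr A.
  rewrite -(mean_trace A n0) /mean (eq_bigr _ (fun j _ => cst j i)) sumr_const.
  by rewrite -[X in X / _]mulr_natr mulfK// pnatr_eq0 cardsT card_ord -lt0n.
rewrite (eq_bigr _ (fun i _ => trE _)) sumr_const card_ord -[X in _ * X]mulr_natl mulKf//.
by rewrite pnatr_eq0 -lt0n.
Qed.

Lemma signed_mean (R : realType) (I : finType) (B : {set I}) (f : I -> R) b :
  mean B (fun x => (-1) ^+ b * f x) = (-1) ^+ b * mean B f.
Proof. by rewrite /mean -mulr_sumr mulrA. Qed.

Theorem theorem7 (R : realType) (n : nat) (A : 'M[R]_n) (eps delta : R)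
    (trA_gt0 : 0 < \tr A) (eps_gt0 : 0 < eps) (delta_gt0 : 0 < delta)
    (d : measure_display) (T : measurableType d) (P : probability T R)
    (N : nat) (N_gt0 : (0 < N)%N) (w : 'I_N -> T -> 'cV[R]_n) :
  (drawn_with_replacement P w ->
   F_bound A eps delta < N%:R ->
   ((1 - delta)%:E <=
      P [set t | (`|trace_estimator A (fun i => w i t) - \tr A|
                    <= eps * \tr A)%R])%E) /\
  (drawn_without_replacement P w ->
   without_replacement_bound n (F_bound A eps delta) <= N%:R ->
   ((1 - delta)%:E <=
      P [set t | (`|trace_estimator A (fun i => w i t) - \tr A|
                    <= eps * \tr A)%R])%E).
Proof.
have n_gt0 : (0 < n)%N.
  by case: (n) A trA_gt0 => // A; rewrite /mxtrace big_ord0 ltxx.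
have NR : 0 < N%:R :> R by rewrite ltr0n.
have nR : 0 < n%:R :> R by rewrite ltr0n.
have [delta_ge1|delta_lt1] := leP 1 delta.
  by split=> _ _; apply: le_trans (measure_ge0 P _); rewrite lee_fin subr_le0.
have [K0|Kn0] := eqVneq (KU A) 0.
  suff H : drawn_from_columns w -> ((1 - delta)%:E <=
      P [set t | (`|trace_estimator A (fun i => w i t) - \tr A|
                    <= eps * \tr A)%R])%E by split => -[] *; apply: H.
  move=> w_cols; rewrite (_ : [set t | _] = setT).
    by rewrite probability_setT lee_fin gerBl ltW.
  apply/seteqP; split=> t // _ /=.
  by rewrite trace_estimator_const// subrr normr0 mulr_ge0 ?ltW.
have K_gt0 : 0 < KU A by rewrite lt_neqAle eq_sym Kn0 KU_ge0.
set K := KU A in K_gt0; set L := ln (2 / delta).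
have L_gt0 : 0 < L by rewrite ln_gt0// ltr_pdivlMr//; lra.
pose c := K * \tr A; have c_gt0 : 0 < c by rewrite mulr_gt0.
have e_ge0 : 0 <= eps * \tr A by rewrite mulr_ge0 ?ltW.
pose f x := n%:R * A x x.
have f_int b : exists a, forall x, a <= (-1) ^+ b * f x <= a + c.
  apply: (interval_of_spread (Ordinal n_gt0)) => i j.
  by rewrite -mulrBr normrMsign diagonal_spread.
have devE (b : bool) (s : seq 'I_n) :
    (-1) ^+ b * (\sum_(x <- s) f x - N%:R * \tr A) =
    \sum_(x <- s) (-1) ^+ b * f x -
    N%:R * mean [set: 'I_n]%SET (fun x => (-1) ^+ b * f x).
  by rewrite signed_mean mean_trace// -mulr_sumr; ring.
have FE : F_bound A eps delta = K ^+ 2 * L / (2 * eps ^+ 2).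
  by rewrite /F_bound /c_bound -/K -/L; field; rewrite lt0r_neq0.
have F_gt0 : 0 < F_bound A eps delta.
  by rewrite FE divr_gt0 ?mulr_gt0 ?exprn_gt0.
set F := F_bound A eps delta in FE F_gt0 *.
have LE : L = F * (2 * eps ^+ 2 / K ^+ 2).
  by rewrite FE; field; rewrite !lt0r_neq0.
have k_gt0 : 0 < 2 * eps ^+ 2 / K ^+ 2.
  by rewrite divr_gt0 ?mulr_gt0 ?exprn_gt0.
split=> [[w_cols Pw indep] FN|[Nn w_cols Pw] FN].
- apply: (@trace_estimator_concentration _ _ _ _ _ _ _ _ xpredT (c ^+ 2 * N%:R)) => //.
  + by rewrite card_tuple card_ord expn_gt0 n_gt0.
  + move=> s _; rewrite card_tuple card_ord.
    have := indep finset.setT (tnth s).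
    rewrite (_ : [set t | _] = draws w s); last first.
      by apply/seteqP; split=> t /= ts i => [|_]; apply: ts; rewrite ?inE.
    move=> ->; under eq_bigr do rewrite Pw.
    by rewrite prodEFin prodr_const cardsT card_ord natrX exprVn.
  + by rewrite mulr_gt0// exprn_gt0.
  + move=> b lam lam0; have [a fa] := f_int b.
    under eq_bigr do rewrite devE.
    apply: le_trans (mgf_with_replacement N c_gt0 lam0 fa) _.
    by rewrite card_tuple [_ / 8 * _](_ : _ = lam ^+ 2 / 8 * (c ^+ 2 * N%:R)); [|ring].
  + rewrite -/L LE [leRHS](_ : _ = N%:R * (2 * eps ^+ 2 / K ^+ 2)).
      by rewrite ler_pM2r// ltW.
    by rewrite /c; field; rewrite !lt0r_neq0.
- have nN : 0 < (n - N).+1%:R :> R by rewrite ltr0n.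
  pose D (s : N.-tuple 'I_n) := all (mem [set: 'I_n]%SET) s && uniq s.
  have cardD : #|D| = n ^_ N.
    rewrite -[RHS](_ : #|[set: 'I_n]%SET| ^_ N = _);
      last by rewrite cardsT card_ord.
    by rewrite -card_uniq_tuples cardsE; apply: eq_card.
  apply: (@trace_estimator_concentration _ _ _ _ _ _ _ _ D
           (c ^+ 2 * (N%:R * (n - N).+1%:R / n%:R))) => //.
  + by rewrite cardD ffact_gt0.
  + by move=> s /andP[_ /tuple_uniqP/Pw]; rewrite cardD.
  + by rewrite !mulr_gt0 ?exprn_gt0 ?invr_gt0.
  + move=> b lam lam0; have [a fa] := f_int b.
    under eq_bigr do rewrite devE.
    have NT : (N <= #|[set: 'I_n]%SET|)%N by rewrite cardsT card_ord.
    apply: le_trans (serfling_mgf c_gt0 lam0 NT (fun x _ => fa x)) _.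
    rewrite cardD cardsT card_ord.
    by rewrite (_ : (lam * c) ^+ 2 / 8 = lam ^+ 2 / 8 * c ^+ 2) ?mulrA//; ring.
  + (* This is F <= N n / (n - N + 1) after clearing denominators. *)
    have {}FN : (n%:R + 1) * F <= N%:R * (F + n%:R).
      move: FN; rewrite /without_replacement_bound gt_eqF//.
      have n1 : 1 <= n%:R :> R by rewrite ler1n.
      rewrite (_ : (n%:R + 1) / _ = (n%:R + 1) * F / (F + n%:R - 1)); last first.
        by field; rewrite !lt0r_neq0//; lra.
      rewrite ler_pdivrMr; last lra.
      by move/le_trans; apply; rewrite ler_wpM2l//; lra.
    rewrite -/L LE [leRHS](_ : _ =
        N%:R * n%:R / (n - N).+1%:R * (2 * eps ^+ 2 / K ^+ 2)).
      rewrite ler_pM2r// ler_pdivlMr// -natr1 natrB//; lra.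
    by rewrite /c; field; rewrite !lt0r_neq0.
Qed.
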